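(* Let $a,b\in\mathbb{Z}$ with $\gcd(a,b)=1$. If $a^2+ab-b^2\equiv 0\pmod 5$, then $M_{(a,b)}=M_L=\{2,4,6,7,14\}\cup\{3^j:j\ge1\}$. Otherwise $M_{(a,b)}=M_F$, where $M_F=\{5^k,\,2\cdot5^k,\,4\cdot5^k,\,3^j\cdot5^k,\,6\cdot5^k,\,7\cdot5^k,\,14\cdot5^k : k\ge0,\ j\ge1\}\setminus\{1\}$.
   Context: For integers $a,b$ with $\gcd(a,b)=1$, the Gibonacci sequence $\{G_n(a,b)\}_{n\ge1}$ is defined by $G_1=a$, $G_2=b$, $G_{n+1}=G_{n-1}+G_n$. A sequence is complete mod $m$ if every residue class modulo $m$ contains some term of the sequence. $M_{(a,b)}$ denotes the set of integers $m\ge2$ such that $\{G_n(a,b)\}$ is complete mod $m$; $M_F=M_{(1,1)}$ (Fibonacci) and $M_L=M_{(1,3)}$ (Lucas). *)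

(* Defs.v *)
From HB Require Import structures.
From mathcomp Require Import all_boot all_order all_algebra.
Set Implicit Arguments. Unset Strict Implicit. Unset Printing Implicit Defensive.
Import Order.TTheory GRing.Theory Num.Theory.
Local Open Scope ring_scope.

(* Auxiliary: gib_pair a b n = (G_{n+1}, G_{n+2}). *)
Fixpoint gib_pair (a b : int) (n : nat) : int * int :=
  match n with
  | O => (a, b)
  | S k => let p := gib_pair a b k in (p.2, p.1 + p.2)
  end.

(* Gibonacci sequence G_n(a,b), indexed from n = 1:
   G_1 = a, G_2 = b, G_{n+1} = G_{n-1} + G_n.  (G_0 is a junk value.) *)
Definition G (a b : int) (n : nat) : int := (gib_pair a b n.-1).1.

Definition complete_mod (a b : int) (m : nat) : Prop :=
  forall r : int, exists n : nat, (1 <= n)%N /\ (G a b n == r %[mod m%:Z])%Z.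

Definition M_ab (a b : int) (m : nat) : Prop := (2 <= m)%N /\ complete_mod a b m.

Definition M_F (m : nat) : Prop := M_ab 1 1 m.
Definition M_L (m : nat) : Prop := M_ab 1 3 m.

Definition ML_explicit (m : nat) : Prop :=
  m = 2%N \/ m = 4%N \/ m = 6%N \/ m = 7%N \/ m = 14%N \/
  exists j : nat, (1 <= j)%N /\ m = (3 ^ j)%N.

Definition MF_explicit (m : nat) : Prop :=
  m <> 1%N /\
  exists k : nat,
    m = (5 ^ k)%N \/ m = (2 * 5 ^ k)%N \/ m = (4 * 5 ^ k)%N \/
    (exists j : nat, (1 <= j)%N /\ m = (3 ^ j * 5 ^ k)%N) \/
    m = (6 * 5 ^ k)%N \/ m = (7 * 5 ^ k)%N \/ m = (14 * 5 ^ k)%N.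

(* Main.v *)
Require Import Defs.
From HB Require Import structures.
From mathcomp Require Import all_boot all_order all_algebra.
From mathcomp Require Import all_fingroup all_field ring zify.
Set Implicit Arguments. Unset Strict Implicit. Unset Printing Implicit Defensive.
Import Order.TTheory GRing.Theory Num.Theory.
Local Open Scope ring_scope.

(* Write F for the Fibonacci numbers, g for the sequence G(a,b), and let
   L_n = 2 g_(n+1) - g_n = g_(n+1) + g_(n-1).

   Sufficiency: for s even, g_(n+2s) - g_n = F_s L_(n+s), and the 3-adic (resp.
   5-adic) valuation of F_s grows by one when s is multiplied by 3 (resp. 5).
   Hence a Hensel-type lifting along arithmetic progressions of indices passes
   from 3^j to 3^(j+1), and from 5^k to 5^(k+1) while staying in a fixed class
   modulo some m prime to 5. The latter needs L_n prime to 5; as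
   L_n^2 = 5 g_n^2 +- 4 (b^2 - ab - a^2), this is where the dichotomy comes from.

   Necessity: a complete g hits 0 modulo m, and is from there on a unit multiple
   of F, so F is complete modulo m. If F is complete modulo a prime p > 10, then
   for each t in F_p one of 5 t^2 + 4, 5 t^2 - 4 is a square. The sum over t of
   the quadratic character of 5 t^2 +- 4 being - (5/p), the set O of the t for
   which both are nonzero squares has at most 3 elements and is closed under
   negation. Weighting the same sum by t^4 and t^8 gives two equations on the
   at most one element of O up to sign, whose resultant forces p = 13 or p = 23.
   These two primes and 8, 12, 18, 21, 28, 49 are excluded by computation. *)

(** * Gibonacci identities *)

(* Shifted by one with respect to [G]: [gib a b n] is [G a b n.+1]. *)
Definition gib (a b : int) (n : nat) : int := (gib_pair a b n).1.
Definition fib (n : nat) : int := gib 0 1 n.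
Definition gibL (a b : int) (n : nat) : int := 2 * gib a b n.+1 - gib a b n.

Lemma gibSS a b n : gib a b n.+2 = gib a b n + gib a b n.+1.
Proof. by []. Qed.

Lemma complete_modP a b m :
  complete_mod a b m <-> forall r, exists n, (m%:Z %| gib a b n - r)%Z.
Proof.
split=> cab r; have [n] := cab r.
  by case=> n_gt0; rewrite eqz_mod_dvd => dv; exists n.-1.
by move=> dv; exists n.+1; split=> //; rewrite eqz_mod_dvd.
Qed.

Lemma complete_dvd a b m d :
  (d %| m)%N -> complete_mod a b m -> complete_mod a b d.
Proof.
move=> dm /complete_modP cab; apply/complete_modP => r.
by have [n dv] := cab r; exists n; apply: dvdz_trans dv.
Qed.

(** The factor [fib s.+1 - fib s] is F_(s-1), in a form that also covers s = 0. The induction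
    carries two consecutive terms. *)
Lemma gib_add a b n s :
  gib a b (n + s) = fib s * gib a b n.+1 + (fib s.+1 - fib s) * gib a b n.
Proof.
have [-> _] // : gib a b (n + s) =
    fib s * gib a b n.+1 + (fib s.+1 - fib s) * gib a b n /\
  gib a b (n + s).+1 = fib s.+1 * gib a b n.+1 + fib s * gib a b n.
elim: s => [|s [IH1 IH2]]; first by rewrite addn0 /fib /gib /=; split; ring.
by rewrite addnS IH2; split; rewrite [fib s.+2]gibSS ?gibSS ?IH1 ?IH2 /fib; ring.
Qed.

Lemma gib_addS a b n s :
  gib a b (n + s).+1 = fib s.+1 * gib a b n.+1 + fib s * gib a b n.
Proof. by rewrite -addSn gib_add gibSS; ring. Qed.

Lemma gib_norm a b n :
  gib a b n.+1 ^+ 2 - gib a b n * gib a b n.+1 - gib a b n ^+ 2 =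
  (-1) ^+ n * (b ^+ 2 - a * b - a ^+ 2).
Proof.
elim: n => [|n IHn]; first by rewrite mul1r.
by rewrite [(-1) ^+ _]exprS -mulrA -IHn gibSS; ring.
Qed.

Lemma fib_norm s : ~~ odd s -> fib s.+1 ^+ 2 = 1 + fib s * fib s.+1 + fib s ^+ 2.
Proof.
move=> s_even; have := gib_norm 0 1 s.
rewrite -signr_odd (negPf s_even) -/(fib s) -/(fib s.+1) => /eqP.
by rewrite [X in _ == X](_ : _ = 1) // !subr_eq => /eqP ->; ring.
Qed.

Lemma gib_shift a b n s : ~~ odd s ->
  gib a b (n + s.*2) - gib a b n = fib s * gibL a b (n + s).
Proof.
move=> /fib_norm N; rewrite -addnn addnA [gib a b (n + s + s)]gib_add /gibL.
rewrite gib_addS gib_add.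
rewrite [X in _ - X](_ : _ =
  (fib s.+1 ^+ 2 - fib s * fib s.+1 - fib s ^+ 2) * gib a b n); first by ring.
by rewrite N; ring.
Qed.

Lemma gibL_shift a b n s : ~~ odd s ->
  gibL a b (n + s.*2) - gibL a b n = 5 * fib s * gib a b (n + s).
Proof.
move=> se; have H1 := gib_shift a b n se; have H2 := gib_shift a b n.+1 se.
transitivity (2 * (gib a b (n.+1 + s.*2) - gib a b n.+1) -
   (gib a b (n + s.*2) - gib a b n)); first by rewrite /gibL addSn; ring.
by rewrite H1 H2 /gibL addSn gibSS; ring.
Qed.

Lemma gibL_sqr a b n :
  gibL a b n ^+ 2 =
  5 * gib a b n ^+ 2 + (-1) ^+ n * 4 * (b ^+ 2 - a * b - a ^+ 2).
Proof. by rewrite mulrAC -gib_norm /gibL; ring. Qed.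

Lemma lucas_double s : ~~ odd s -> gibL 0 1 s.*2 = 5 * fib s ^+ 2 + 2.
Proof.
move=> /(gibL_shift 0 1 0); rewrite add0n -/(fib s) => /eqP.
by rewrite subr_eq => /eqP ->; rewrite -/(fib s) /gibL /gib /=; ring.
Qed.

Lemma fib_triple s : ~~ odd s -> fib (3 * s) = fib s * (5 * fib s ^+ 2 + 3).
Proof.
move=> se; have -> : (3 * s = s + s.*2)%N by lia.
have /eqP := gib_shift 0 1 s se; rewrite subr_eq addnn lucas_double // => /eqP.
by rewrite /fib => ->; ring.
Qed.

Lemma fib_quintuple s : ~~ odd s ->
  fib (5 * s) = 5 * fib s * (5 * fib s ^+ 4 + 5 * fib s ^+ 2 + 1).
Proof.
move=> se; have -> : (5 * s = 3 * s + s.*2)%N by lia.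
have /eqP := gib_shift 0 1 (3 * s) se.
have -> : (3 * s + s = s.*2.*2)%N by lia.
rewrite subr_eq lucas_double ?odd_double // -/(fib _) -[gib 0 1 (3 * s)]/(fib _).
move=> /eqP ->; rewrite fib_triple //.
have := gib_shift 0 1 0 se; rewrite add0n subr0 -/(fib _) -/(fib _) => ->.
rewrite exprMn gibL_sqr -signr_odd (negPf se) /fib; ring.
Qed.

(** * Lifting modulo powers of 3 and 5 *)

Lemma prime_dvdzM q (x y : int) : prime q ->
  (q%:Z %| x * y)%Z = (q%:Z %| x)%Z || (q%:Z %| y)%Z.
Proof. by move=> q_pr; rewrite !dvdzE abszM /= Euclid_dvdM. Qed.

Lemma prime_dvdzX q (x : int) n : prime q -> (0 < n)%N ->
  (q%:Z %| x ^+ n)%Z = (q%:Z %| x)%Z.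
Proof. by move=> q_pr n_gt0; rewrite !dvdzE abszX /= Euclid_dvdX // n_gt0 andbT. Qed.

Lemma dvdz_addl (d m n : int) : (d %| m)%Z -> (d %| m + n)%Z = (d %| n)%Z.
Proof. exact: rpredDl. Qed.

(** Modulo q^(k+1) the sequence advances by the constant step q^k y with y a unit modulo q, so it
    runs through all q lifts of the class of [x 0] modulo q^k. *)
Lemma lift_residue (q k : nat) (x : nat -> int) (y r : int) :
    prime q -> ~~ (q%:Z %| y)%Z ->
    (forall i, ((q ^ k.+1)%N%:Z %| x i.+1 - x i - (q ^ k)%N%:Z * y)%Z) ->
    ((q ^ k)%N%:Z %| r - x 0%N)%Z ->
  exists i, ((q ^ k.+1)%N%:Z %| x i - r)%Z.
Proof.
move=> q_pr qNy xS /dvdzP[z Ez].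
have q_gt0 := prime_gt0 q_pr.
have /coprimezP[[u v] /= Euv] : coprimez y q.
  by rewrite coprimez_sym coprimezE prime_coprime // -dvdzE.
have xD i : ((q ^ k.+1)%N%:Z %| x i - x 0%N - i%:Z * ((q ^ k)%N%:Z * y))%Z.
  elim: i => [|i IHi]; first by rewrite subrr mul0r subr0 dvdz0.
  rewrite (_ : _ - _ = (x i.+1 - x i - (q ^ k)%N%:Z * y) +
     (x i - x 0%N - i%:Z * ((q ^ k)%N%:Z * y))); last by rewrite intS; ring.
  by rewrite rpredD.
(* Here z = (r - x 0) / q^k and u is inverse to y modulo q; the reduction modulo q makes the index a
   natural number. *)
pose w : int := z * u; exists `|(w %% q)%Z|%N.
set i := `|_|%N.
have Ei : i%:Z = w - (w %/ q)%Z * q%:Z.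
  by rewrite /i gez0_abs ?modz_ge0 ?lt0r_neq0 //; rewrite {2}(divz_eq w q%:Z); ring.
rewrite (_ : x i - r = (x i - x 0%N - i%:Z * ((q ^ k)%N%:Z * y)) +
   (i%:Z * ((q ^ k)%N%:Z * y) - (r - x 0%N))); last by ring.
rewrite rpredD // Ez.
rewrite (_ : _ - _ = (q ^ k)%N%:Z * (i%:Z * y - z)); last by ring.
rewrite expnSr PoszM dvdz_mul2l; last by rewrite -lt0n expn_gt0 q_gt0.
apply/dvdzP; exists (- z * v - (w %/ q)%Z * y); rewrite Ei /w.
by rewrite -[X in _ * y - X]mulr1 -Euv; ring.
Qed.

Lemma gibL_mod q a b n s i : ~~ odd s -> (q %| 5 * fib s)%Z ->
  (q %| gibL a b (n + i * s.*2) - gibL a b n)%Z.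
Proof.
move=> se qs; elim: i => [|i IHi]; first by rewrite addn0 subrr dvdz0.
rewrite mulSn addnCA addnC.
have := gibL_shift a b (n + i * s.*2) se => /eqP; rewrite subr_eq => /eqP ->.
by rewrite -addrA rpredD // dvdz_mulr.
Qed.

(** Along the indices n + 2 s i the increments are F_s L, with L constant modulo q because q divides
    5 F_s: this is the constant step of [lift_residue]. *)
Lemma gib_lift q k a b n s (y r : int) :
    prime q -> ~~ odd s -> (q%:Z %| 5 * fib s)%Z ->
    fib s = (q ^ k)%N%:Z * y -> ~~ (q%:Z %| y)%Z ->
    ~~ (q%:Z %| gibL a b (n + s))%Z -> ((q ^ k)%N%:Z %| r - gib a b n)%Z ->
  exists i, ((q ^ k.+1)%N%:Z %| gib a b (n + i * s.*2) - r)%Z.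
Proof.
move=> q_pr se qs Ey qNy qNL dv.
apply: (@lift_residue q k _ (y * gibL a b (n + s))) => //; last 1 first.
- by rewrite addn0.
- by rewrite prime_dvdzM // negb_or qNy.
move=> i; rewrite mulSn addnCA addnC gib_shift // Ey.
have -> : (n + i * s.*2 + s = n + s + i * s.*2)%N by lia.
have /dvdzP[z Ez] := gibL_mod a b (n + s) i se qs.
apply/dvdzP; exists (y * z); rewrite expnSr PoszM.
transitivity ((q ^ k)%N%:Z * y * (gibL a b (n + s + i * s.*2) - gibL a b (n + s))).
  by ring.
by rewrite Ez; ring.
Qed.

Lemma fib_dvd5 n : (5 %| fib n)%Z -> (5 %| n)%N.
Proof.
elim/ltn_ind: n => -[|[|[|[|[|n]]]]] IHn //.
rewrite (_ : fib n.+4.+1 = 5 * fib n.+1 + 3 * fib n); last first.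
  by rewrite /fib !gibSS; ring.
rewrite dvdz_addl; last exact: dvdz_mulr.
rewrite (@prime_dvdzM 5) // => /orP[ // | /IHn dv].
by rewrite -[n.+4.+1]/(5 + n)%N dvdn_add // dv //; lia.
Qed.

(** The last factor in [fib_quintuple] is 1 modulo 5, so each factor 5 in the index adds exactly one
    to the valuation; [fib_dvd5] gives the start. *)
Lemma fib_pow5 s k : ~~ odd s -> ~~ (5 %| s)%N ->
  exists2 y, fib (5 ^ k * s) = (5 ^ k)%N%:Z * y & ~~ (5 %| y)%Z.
Proof.
move=> se sN5; elim: k => [|k [y Ey yN5]].
  by exists (fib s); rewrite ?mul1n ?mul1r //; apply: contra sN5; apply: fib_dvd5.
exists (y * (5 * (fib (5 ^ k * s) ^+ 4 + fib (5 ^ k * s) ^+ 2) + 1)).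
  rewrite expnS -mulnA fib_quintuple ?oddM ?negb_and ?se ?orbT // PoszM.
  by rewrite {1}Ey; ring.
by rewrite (@prime_dvdzM 5) // negb_or yN5 dvdz_addl ?dvdz_mulr.
Qed.

(** The induction starts from F_4 = 3; as 3 divides F_s, the cofactor 5 F_s^2 + 3 in [fib_triple]
    has exactly one factor 3. *)
Lemma fib_pow3 j :
  exists2 y, fib (3 ^ j * 4) = (3 ^ j.+1)%N%:Z * y & ~~ (3 %| y)%Z.
Proof.
elim: j => [|j [y Ey yN3]]; first by exists 1.
set f := fib _ in Ey.
exists (y * (3 * (5 * ((3 ^ j)%N%:Z * y) ^+ 2) + 1)).
  rewrite expnS -mulnA fib_triple ?oddM ?andbF // -/f [in RHS]expnS PoszM.
  have Ef : f = 3%:Z * ((3 ^ j)%N%:Z * y) by rewrite Ey expnS PoszM mulrA.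
  by rewrite {2}Ef Ey; ring.
by rewrite (@prime_dvdzM 3) // negb_or yN3 dvdz_addl ?dvdz_mulr.
Qed.

Lemma gibL_ndvd5 a b n : ~~ (5 %| a ^+ 2 + a * b - b ^+ 2)%Z ->
  ~~ (5 %| gibL a b n)%Z.
Proof.
apply: contra => dv; have := dvdz_mull (gibL a b n) dv.
rewrite -expr2 gibL_sqr dvdz_addl; last exact: dvdz_mulr.
rewrite -mulrA (@prime_dvdzM 5) //.
rewrite (@dvdzE _ (_ ^+ _)) abszX exp1n /= (@prime_dvdzM 5) //= -rpredN.
by congr (_ %| _)%Z; ring.
Qed.

(** All indices stay in the class of n modulo 2 s, so that a condition modulo a divisor of F_s can
    be kept at the same time. *)
Lemma gib_hits_pow5 a b s k n r : ~~ (5 %| a ^+ 2 + a * b - b ^+ 2)%Z ->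
    ~~ odd s -> ~~ (5 %| s)%N ->
  exists i, ((5 ^ k)%N%:Z %| gib a b (n + i * s.*2) - r)%Z.
Proof.
move=> D5 se sN5; elim: k => [|k [i IHi]].
  by exists 0%N; rewrite dvdzE dvd1n.
have [y Ey yN5] := fib_pow5 k se sN5.
have [|||i' dv'] := @gib_lift 5 k a b (n + i * s.*2) (5 ^ k * s) y r isT _ _ Ey yN5
  (gibL_ndvd5 _ D5).
- by rewrite oddM negb_and se orbT.
- by rewrite dvdz_mulr.
- by rewrite -rpredN opprB.
exists (i + 5 ^ k * i')%N; congr (is_true (_ %| gib _ _ _ - _)%Z): dv'; lia.
Qed.

Lemma complete_mul_pow5 a b m s k : ~~ (5 %| a ^+ 2 + a * b - b ^+ 2)%Z ->
    ~~ odd s -> ~~ (5 %| s)%N -> (m%:Z %| fib s)%Z -> coprime m 5 ->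
  complete_mod a b m -> complete_mod a b (m * 5 ^ k).
Proof.
move=> D5 se sN5 ms m5 /complete_modP cab; apply/complete_modP => r.
have [n dvn] := cab r; have [i dvi] := gib_hits_pow5 k n r D5 se sN5.
exists (n + i * s.*2)%N; rewrite PoszM Gauss_dvdz; last first.
  by rewrite coprimezE coprimeXr.
rewrite dvi andbT {dvi}; elim: i => [|i IHi]; first by rewrite addn0.
rewrite mulSn addnCA addnC -(subrK (gib a b (n + i * s.*2)) (gib _ _ (_ + s.*2))).
by rewrite gib_shift // -addrA rpredD // dvdz_mulr.
Qed.

(** * Residues modulo small numbers *)

Definition step_mod (m : nat) (st : nat * nat) : nat * nat :=
  (st.2, ((st.1 + st.2) %% m)%N).
Definition res (m : nat) (x : int) : nat := `|(x %% m%:Z)%Z|%N.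

Lemma resE m x : (0 < m)%N -> (res m x)%:Z = (x %% m%:Z)%Z.
Proof. by move=> m_gt0; rewrite gez0_abs // modz_ge0 // -lt0n. Qed.

Lemma res_lt m x : (0 < m)%N -> (res m x < m)%N.
Proof. by move=> m_gt0; rewrite -ltz_nat resE // ltz_pmod. Qed.

Lemma eq_res m x y : (0 < m)%N -> (res m x == res m y) = (m%:Z %| x - y)%Z.
Proof. by move=> m_gt0; rewrite -eqz_nat !resE // -eqz_mod_dvd. Qed.

Lemma res_nat m n : res m n%:Z = (n %% m)%N.
Proof. by rewrite /res modz_nat. Qed.

Lemma res_add m x y : (0 < m)%N -> res m (x + y) = ((res m x + res m y) %% m)%N.
Proof.
by move=> m_gt0; rewrite -res_nat; apply/eqP; rewrite eq_res // PoszD !resE //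
  -eqz_mod_dvd modzDm.
Qed.

Lemma res_gib m a b n : (0 < m)%N ->
  iter n (step_mod m) (res m a, res m b) = (res m (gib a b n), res m (gib a b n.+1)).
Proof.
move=> m_gt0; elim: n => [|n IHn] //.
by rewrite iterS IHn /step_mod /= gibSS res_add.
Qed.

(** The list [s] contains the initial state and is closed under the step, so it contains every state
    of the sequence. *)
Lemma not_complete_fib m r N (s := traject (step_mod m) (0%N, 1%N) N) :
    [&& (1 < m)%N, (r < m)%N, (0%N, 1%N) \in s, all (fun st => step_mod m st \in s) s &
      all (fun st => st.1 != r) s] ->
  ~ complete_mod 0 1 m.
Proof.
case/and5P=> m_gt1 r_lt s0 sS sr /complete_modP/(_ r%:Z)[n].
have m_gt0 : (0 < m)%N by apply: ltnW.
rewrite -eq_res // res_nat modn_small // => /eqP Er.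
have := res_gib 0 1 n m_gt0; rewrite Er.
have -> : res m 0 = 0%N by exact: etrans (res_nat m 0) (mod0n m).
have -> : res m 1 = 1%N by exact: etrans (res_nat m 1) (modn_small m_gt1).
have : iter n (step_mod m) (0, 1)%N \in s.
  by elim: n {Er} => [|n IHn] //=; apply: (allP sS).
by move=> /(allP sr) /[swap] ->; rewrite eqxx.
Qed.

Lemma coprime_res m a b : (0 < m)%N -> coprimez a b ->
  coprime (gcdn (res m a) (res m b)) m.
Proof.
move=> m_gt0 /eqP ab; set d := gcdn (gcdn (res m a) (res m b)) m.
have dm : (d %| m)%N by apply: dvdn_gcdr.
have dres x : (d %| res m x)%N -> (d%:Z %| x)%Z.
  by move=> dx; rewrite (divz_eq x m%:Z) dvdz_addl -?resE // dvdz_mull.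
have : (d%:Z %| gcdz a b)%Z.
  by rewrite dvdz_gcd !dres // (dvdn_trans (dvdn_gcdl _ _)) ?dvdn_gcdl ?dvdn_gcdr.
by rewrite ab dvdz1.
Qed.

Lemma all_iota_ltn (P : pred nat) m : all P (iota 0 m) -> forall i, (i < m)%N -> P i.
Proof. by move=> /allP Pm i im; apply: Pm; rewrite mem_iota. Qed.

Definition residues_check (T : nat -> nat -> pred (nat * nat)) (m N : nat) : bool :=
  all (fun a => all (fun b => coprime (gcdn a b) m ==>
      all (fun r => has (T a r) (traject (step_mod m) (a, b) N)) (iota 0 m))
      (iota 0 m)) (iota 0 m).

Lemma gib_residues T m N a b : residues_check T m N ->
    (0 < m)%N -> coprimez a b ->
  forall r, exists n, T (res m a) (res m r) (res m (gib a b n), res m (gib a b n.+1)).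
Proof.
move=> chk m_gt0 cab r.
have /all_iota_ltn/(_ _ (res_lt b m_gt0)) := all_iota_ltn chk (res_lt a m_gt0).
rewrite coprime_res //= => /all_iota_ltn/(_ _ (res_lt r m_gt0))/hasP[st].
by case/trajectP=> n _ ->; rewrite res_gib // => ?; exists n.
Qed.

(** The Fibonacci periods modulo these numbers are 1, 3, 6, 24, 16 and 48, all divisors of 48. *)
Lemma residues_check_small :
  all (fun m => residues_check (fun _ r st => st.1 == r) m 48) [:: 1; 2; 4; 6; 7; 14]%N.
Proof. by vm_compute. Qed.

Lemma complete_small a b m : coprimez a b -> m \in [:: 1; 2; 4; 6; 7; 14]%N ->
  complete_mod a b m.
Proof.
move=> cab m_in; apply/complete_modP => r.
have m_gt0 : (0 < m)%N by move: m_in; rewrite !inE; lia.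
have [n /= /eqP E] := gib_residues (allP residues_check_small m m_in) m_gt0 cab r.
by exists n; rewrite -eq_res // E.
Qed.

Lemma fib24 m : m \in [:: 1; 2; 4; 6; 7; 14]%N -> (m%:Z %| fib 24)%Z.
Proof.
move=> m_in; have m_gt0 : (0 < m)%N by move: m_in; rewrite !inE; lia.
rewrite -[fib 24]subr0 (gib_shift 0 1 0 (isT : ~~ odd 12)).
have -> : fib 12 * gibL 0 1 (0 + 12) = (144 * 322)%N%:Z.
  by rewrite PoszM; congr (_ * _); vm_compute.
rewrite dvdzE /= !inE in m_in *.
by move: m_in; do ![case/predU1P=> [->|] //]; move=> /eqP ->.
Qed.

(** Start of the lift for 3: every residue must occur at an index with L_n prime to 3. Modulo 3 the
    sum of the state is -L_n, and 8 is the Fibonacci period. *)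
Lemma residues_check3 : residues_check
  (fun _ r st => (st.1 == r) && (~~ (3 %| st.1 + st.2)%N)) 3 8.
Proof. by []. Qed.

Lemma gibL_mod3 a b n : (3 %| gibL a b n)%Z = (3 %| res 3 (gib a b n) + res 3 (gib a b n.+1))%N.
Proof.
rewrite /dvdn -res_add // -gibSS 
  (_ : _ == _ = (3 %| gib a b n.+2)%Z); last by rewrite -[X in (_ %| X)%Z]subr0 -eq_res.
rewrite -[RHS]rpredN.
rewrite -[RHS](@dvdz_addl _ (3 * gib a b n.+1)) ?dvdz_mulr //.
by congr (_ %| _)%Z; rewrite /gibL gibSS; ring.
Qed.

(** Some L_n may vanish modulo 3, so the induction also carries that L_n is prime to 3; L is
    constant modulo 3 along the lifting progression. *)
Lemma gib_hits_pow3 a b j r : coprimez a b ->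
  exists2 n, ((3 ^ j.+1)%N%:Z %| gib a b n - r)%Z & ~~ (3 %| gibL a b n)%Z.
Proof.
move=> cab; elim: j => [|j [n dvn n3]].
  have [n /= /andP[/eqP E n3]] := gib_residues residues_check3 isT cab r.
  by exists n; rewrite ?gibL_mod3 // -eq_res // E.
have [y Ey yN3] := fib_pow3 j.
have f3 : (3 %| fib (3 ^ j * 4))%Z by rewrite Ey expnS PoszM -mulrA dvdz_mulr.
have se : ~~ odd (3 ^ j * 4) by rewrite oddM andbF.
have [|||i dvi] := @gib_lift 3 j.+1 a b n (3 ^ j * 4) y r isT se _ Ey yN3.
- by rewrite dvdz_mull.
(* L_(n+s) is F_(s+1) L_n modulo F_s, and F_(s+1)^2 is 1 modulo 3. *)
- rewrite /gibL gib_addS gib_add.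
  set s := (3 ^ j * 4)%N in f3 se *.
  rewrite (_ : _ - _ = fib s * (2 * gib a b n + fib s * 0 - gib a b n.+1 + gib a b n)
     + fib s.+1 * gibL a b n); last by rewrite /gibL; ring.
  rewrite dvdz_addl; last exact: dvdz_mulr.
  rewrite (@prime_dvdzM 3) // negb_or n3 andbT -(@prime_dvdzX 3 _ 2) // fib_norm //.
  by rewrite -addrA addrC dvdz_addl // rpredD ?dvdz_mulr ?dvdz_exp.
- by rewrite -rpredN opprB.
exists (n + i * (3 ^ j * 4).*2)%N => //; apply: contra n3 => dvL.
have := gibL_mod a b n i se (dvdz_mull 5 f3).
by rewrite dvdz_addl // rpredN.
Qed.

Lemma complete_pow3 a b j : coprimez a b -> complete_mod a b (3 ^ j).
Proof.
move=> cab; apply: (@complete_dvd _ _ (3 ^ j.+1)); first by rewrite dvdn_exp2l.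
by apply/complete_modP => r; have [n] := gib_hits_pow3 j r cab; exists n.
Qed.

(** * Sufficiency of the explicit lists *)

Lemma ML_complete a b m : coprimez a b -> ML_explicit m -> M_ab a b m.
Proof.
move=> cab mL; split.
  by case: mL => [|[|[|[|[|[[|j] [] // _]]]]]] -> //; rewrite expnS; lia.
case: mL => [|[|[|[|[|[j [_ ->]]]]]]]; last exact: complete_pow3;
  by move=> ->; apply: complete_small.
Qed.

Lemma MF_complete a b m : coprimez a b -> ~~ (5 %| a ^+ 2 + a * b - b ^+ 2)%Z ->
  MF_explicit m -> M_ab a b m.
Proof.
move=> cab D5 [m1 [k mF]]; split.
  rewrite ltn_neqAle eq_sym; apply/andP; split; first exact/eqP.
  have k0 : (0 < 5 ^ k)%N by rewrite expn_gt0.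
  by case: mF => [|[|[|[[j [_]]|[|[]]]]]] ->; rewrite ?muln_gt0 ?expn_gt0 ?k0.
have small i : i \in [:: 1; 2; 4; 6; 7; 14]%N -> complete_mod a b (i * 5 ^ k).
  (* The index 24 is even and prime to 5, and F_24 is divisible by every number of the list. *)
  move=> i_in; apply: (@complete_mul_pow5 _ _ _ 24) => //; last exact: complete_small.
    exact: fib24.
  by move: i_in; rewrite !inE; do ![case/predU1P=> [->|] //]; move=> /eqP ->.
case: mF => [|[|[|[[j [j_gt0 ->]]|[|[]]]]]]; last 1 first.
all: try by move=> ->; apply: small.
  by move=> ->; rewrite -[(5 ^ k)%N]mul1n; apply: small.
have [y Ey _] := fib_pow3 j.
apply: (@complete_mul_pow5 _ _ _ (3 ^ j * 4)) => //; last exact: complete_pow3.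
- by rewrite oddM andbF.
- by rewrite Euclid_dvdM // Euclid_dvdX.
- by rewrite Ey expnSr PoszM -mulrA dvdz_mulr.
- by rewrite coprimeXl.
Qed.

(** * Reduction to the Fibonacci sequence *)

Lemma gib_period a b m : (0 < m)%N ->
  exists2 N, (0 < N)%N & forall n, (m%:Z %| gib a b (n + N) - gib a b n)%Z.
Proof.
move=> m_gt0; pose o x := Ordinal (res_lt x m_gt0).
pose F (n : 'I_(m * m).+1) := (o (gib a b n), o (gib a b n.+1)).
have /injectivePn : ~~ injectiveb F.
  apply/negP=> /injectiveP/leq_card; rewrite card_prod !card_ord; lia.
have eqo x y : res m x = res m y -> (m%:Z %| y - x)%Z.
  by move=> /esym/eqP; rewrite eq_res.
case=> i0 [j0 ne_ij]; wlog lt_ij : i0 j0 ne_ij / (i0 < j0)%N.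
  move=> W; move: (ne_ij); rewrite neq_ltn => /orP[|lt]; first exact: W.
  by move/esym; apply: W; rewrite // eq_sym.
case: i0 j0 lt_ij {ne_ij} => i ilt [j jlt] /= lt_ij; rewrite /F /= => -[E1 E2].
have {}E1 := eqo _ _ E1; have {}E2 := eqo _ _ E2.
exists (j - i)%N; first by rewrite subn_gt0.
have Ej : j = (i + (j - i))%N by rewrite subnKC // ltnW.
move: (j - i)%N Ej => N Ej; rewrite {}Ej {ilt jlt lt_ij} in E1 E2.
have back k : (m%:Z %| gib a b (k.+1 + N) - gib a b k.+1)%Z ->
   (m%:Z %| gib a b (k.+2 + N) - gib a b k.+2)%Z -> (m%:Z %| gib a b (k + N) - gib a b k)%Z.
  move=> H1 H2; rewrite (_ : _ - _ = (gib a b (k.+2 + N) - gib a b k.+2) -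
    (gib a b (k.+1 + N) - gib a b k.+1)); last by rewrite !addSn !gibSS; ring.
  by rewrite rpredB.
have fwd k : (m%:Z %| gib a b (k + N) - gib a b k)%Z ->
   (m%:Z %| gib a b (k.+1 + N) - gib a b k.+1)%Z ->
   (m%:Z %| gib a b (k.+2 + N) - gib a b k.+2)%Z.
  move=> H1 H2; rewrite (_ : _ - _ = (gib a b (k + N) - gib a b k) +
    (gib a b (k.+1 + N) - gib a b k.+1)); last by rewrite !addSn !gibSS; ring.
  by rewrite rpredD.
(* The recurrence also runs backwards: the repetition is moved down to index 0, then forward to all
   n. *)
rewrite -addSn in E2; elim: i E1 E2 => [|i IHi] E1 E2; last by apply: IHi => //; apply: back.
move=> n; have [] // : (m%:Z %| gib a b (n + N) - gib a b n)%Z /\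
  (m%:Z %| gib a b (n.+1 + N) - gib a b n.+1)%Z.
by elim: n => [|n [IH1 IH2]] //; split=> //; apply: fwd.
Qed.

(* A term divisible by [m] is followed by a unit [u], and from there on the
   sequence is [u] times the Fibonacci sequence modulo [m]. *)
Lemma complete_fib a b m : (0 < m)%N -> complete_mod a b m -> complete_mod 0 1 m.
Proof.
move=> m_gt0 /complete_modP cab; have [N N_gt0 per] := gib_period a b m_gt0.
have [n0] := cab 0; rewrite subr0 => dv0.
have hit r : exists i, (m%:Z %| fib i * gib a b n0.+1 - r)%Z.
  have [n dvn] := cab r.
  have dvk k : (m%:Z %| gib a b (n + k * N) - r)%Z.
    elim: k => [|k IHk]; first by rewrite addn0.
    by rewrite mulSn addnCA addnC -(subrK (gib a b (n + k * N)) (gib _ _ _)) -addrA rpredD.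
  (* As N > 0, adding n0 periods brings the index to at least n0. *)
  exists (n + n0 * N - n0)%N; have := dvk n0.
  rewrite -{1}[(n + n0 * N)%N](@subnKC n0); last by nia.
  rewrite gib_add addrAC [X in (_ %| X)%Z]addrC dvdz_addl ?dvdz_mull //.
(* F_i is an inverse of u = g_(n0+1) modulo m, and j will be an index with F_j u = r u. *)
have [i dvi] := hit 1; apply/complete_modP => r.
have [j dvj] := hit (r * gib a b n0.+1); exists j.
rewrite -/(fib j) (_ : _ - _ = fib i * (fib j * gib a b n0.+1 - r * gib a b n0.+1)
  - (fib i * gib a b n0.+1 - 1) * (fib j - r)); last by ring.
by apply: rpredB; [exact: dvdz_mull | exact: dvdz_mulr].
Qed.

(** Each line gives the modulus, a residue that is missed, and the Fibonacci period. *)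
Lemma not_complete_small d : d \in [:: 8; 12; 13; 18; 21; 23; 28; 49]%N ->
  ~ complete_mod 0 1 d.
Proof.
rewrite !inE; do 7?[case/predU1P=> [->|]]; last move/eqP->.
- by apply: (@not_complete_fib 8 4 12); vm_compute.
- by apply: (@not_complete_fib 12 6 24); vm_compute.
- by apply: (@not_complete_fib 13 4 28); vm_compute.
- by apply: (@not_complete_fib 18 4 24); vm_compute.
- by apply: (@not_complete_fib 21 4 16); vm_compute.
- by apply: (@not_complete_fib 23 4 48); vm_compute.
- by apply: (@not_complete_fib 28 10 48); vm_compute.
- by apply: (@not_complete_fib 49 4 112); vm_compute.
Qed.

(** * Character sums *)

Lemma natr_card (F : finFieldType) : #|F|%:R = 0 :> F.
Proof.
have : \sum_(t : F) t = \sum_(t : F) (t + 1) by apply: reindex_inj (addIr 1).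
by rewrite big_split /= sumr_const -[X in X = _]addr0 => /addrI/esym.
Qed.

Lemma expf_card1 (F : finFieldType) (t : F) : t != 0 -> t ^+ #|F|.-1 = 1.
Proof.
move=> t_neq0; apply: (mulfI t_neq0).
by rewrite mulr1 -exprS (prednK (ltnW (card_finNzRing_gt1 F))) expf_card.
Qed.

(** If q - 1 divides k, all nonzero terms are 1. Otherwise t^k differs from 1 for some nonzero t,
    and multiplication by t permutes the field while scaling the sum by t^k. *)
Lemma sum_expf (F : finFieldType) k : (0 < k)%N ->
  \sum_(t : F) t ^+ k = - (#|F|.-1 %| k)%:R.
Proof.
move=> k_gt0; set q1 := #|F|.-1.
have card_unit : #|[pred t : F | t != 0]| = q1.
  by rewrite /q1 -(cardC1 (0 : F)); apply: eq_card => t; rewrite !inE.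
have q1_gt0 : (0 < q1)%N.
  by rewrite -card_unit; apply/card_gt0P; exists 1; rewrite inE oner_neq0.
have [dv|ndv] := boolP (q1 %| k)%N.
  rewrite (bigD1 0) //= expr0n gtn_eqF // add0r.
  rewrite (eq_bigr (fun=> 1)); last first.
    by move=> t t0; rewrite -(divnK dv) mulnC exprM expf_card1 ?expr1n.
  rewrite sumr_const card_unit; apply/eqP; rewrite -addr_eq0.
  by rewrite natr1 (prednK (ltnW (card_finNzRing_gt1 F))) natr_card.
set r := (k %% q1)%N; have r_gt0 : (0 < r)%N by rewrite lt0n -/(dvdn _ _).
(* X^r - 1 has at most r < q - 1 roots. *)
have [t t0 tr] : exists2 t : F, t != 0 & t ^+ r != 1.
  apply/exists_inP; apply: contraT; rewrite negb_exists_in => /forall_inP tr.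
  have : (size (enum [pred t : F | t != 0%R]) <= r)%N.
    apply: max_unity_roots; rewrite ?enum_uniq //; apply/allP => t.
    by rewrite mem_enum inE => /tr; rewrite negbK unity_rootE.
  by rewrite -cardE card_unit leqNgt ltn_mod q1_gt0.
have {}tr : t ^+ k != 1.
  by rewrite (divn_eq k q1) exprD mulnC exprM expf_card1 // expr1n mul1r.
apply/eqP; rewrite oppr0; apply: contraR tr => S0; apply/eqP; apply: (mulIf S0).
rewrite mul1r [RHS](reindex_inj (mulfI t0)) mulr_sumr.
by apply: eq_bigr => u _; rewrite exprMn.
Qed.

(** In the binomial expansion the i-th term has exponent 2 (j + h - i) < 4 h. Its power sum survives
    only at a positive multiple of 2 h, that is for i = j. *)
Lemma sum_quadratic_powers (F : finFieldType) (h j : nat) (c d : F) :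
    #|F|.-1 = h.*2 -> (j < h)%N ->
  \sum_(t : F) t ^+ j.*2 * (d * t ^+ 2 + c) ^+ h =
  - (d ^+ (h - j) * c ^+ j *+ 'C(h, j)).
Proof.
move=> q1E jh.
have term (t : F) i : t ^+ j.*2 * ((d * t ^+ 2) ^+ (h - i) * c ^+ i *+ 'C(h, i)) =
    (d ^+ (h - i) * c ^+ i *+ 'C(h, i)) * t ^+ (j + (h - i)).*2.
  rewrite doubleD -(mul2n (h - i)) exprD exprMn -exprM mulrnAr mulrnAl; congr (_ *+ _).
  by rewrite mulrCA -!mulrA; congr (_ * _); rewrite mulrCA mulrA mulrC.
under eq_bigr => t _.
  rewrite exprDn mulr_sumr; under eq_bigr do rewrite term.
  over.
rewrite exchange_big /= (bigD1 (inord j)) //= inordK ?ltnS 1?ltnW //.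
rewrite subnKC 1?ltnW // -mulr_sumr sum_expf ?q1E ?dvdnn ?double_gt0 ?mulrN1; last by lia.
rewrite [X in _ + X]big1 ?addr0 // => i ij.
rewrite -mulr_sumr; have [/eqP|k_gt0] := posnP (j + (h - i)).
  rewrite addn_eq0 => /andP[/eqP -> /eqP ->].
  by under eq_bigr do rewrite expr0; rewrite sumr_const natr_card mulr0.
rewrite sum_expf ?double_gt0 // q1E -!muln2 dvdn_pmul2r //.
case: dvdnP => [[k Ek]|_]; last by rewrite oppr0 mulr0.
have {}ij : nat_of_ord i != j by rewrite -(inj_eq val_inj) /= inordK ?ltnS 1?ltnW in ij.
have := ltn_ord i; case: k Ek => [|[|k]]; nia.
Qed.

(** Comparing enumeration ranks selects one element of each pair t, -t with t nonzero. *)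
Lemma sum_even (F : finFieldType) (V : nmodType) (g : F -> V) :
    (2%:R : F) != 0 -> (forall t, g (- t) = g t) ->
  \sum_t g t = g 0 + (\sum_(t | (enum_rank t < enum_rank (- t))%N) g t) *+ 2.
Proof.
move=> two gN; rewrite (bigID (fun t => (enum_rank t < enum_rank (- t))%N)) /=.
rewrite addrC (bigD1 0) ?oppr0 ?ltnn //= -addrA; congr (_ + _).
rewrite mulr2n; congr (_ + _).
rewrite (reindex_inj oppr_inj) /=; apply: eq_big => // t.
rewrite opprK oppr_eq0 -leqNgt leq_eqVlt.
have [->|t0] := eqVneq t 0; first by rewrite oppr0 ltnn andbF.
rewrite andbT; case: eqP => //= /val_inj/enum_rank_inj/eqP.
by rewrite -addr_eq0 -mulr2n -mulr_natl mulf_eq0 (negPf two) (negPf t0).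
Qed.

(** Quadratic character by Euler's criterion, valued in [int] so that its sums can be bounded and
    compared with cardinals. *)
Definition qchar (F : finFieldType) (z : F) : int :=
  if z == 0 then 0 else if z ^+ #|F|.-1./2 == 1 then 1 else -1.

Lemma qcharE (F : finFieldType) (h : nat) (z : F) : #|F|.-1 = h.*2 -> (0 < h)%N ->
  (qchar z)%:~R = z ^+ h.
Proof.
move=> q1E h_gt0; rewrite /qchar q1E doubleK.
have [->|z0] := eqVneq z 0; first by rewrite expr0n gtn_eqF.
case: eqP => [->|/eqP zh] //.
have /eqP := expf_card1 z0; rewrite q1E -muln2 exprM sqrf_eq1 (negPf zh) /= => /eqP ->.
by rewrite mulrNz.
Qed.

Lemma qchar_sqr (F : finFieldType) (h : nat) (z : F) : #|F|.-1 = h.*2 ->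
  qchar (z ^+ 2) != -1.
Proof.
move=> q1E; rewrite /qchar; have [->|z0] := eqVneq z 0; first by rewrite expr0n eqxx.
by rewrite expf_eq0 (negPf z0) -exprM mul2n q1E doubleK -q1E expf_card1 // eqxx.
Qed.

Lemma qchar_cases (F : finFieldType) (z : F) : z != 0 -> qchar z = 1 \/ qchar z = -1.
Proof. by move=> z0; rewrite /qchar (negPf z0); case: ifP; [left|right]. Qed.

Lemma qchar_bound (F : finFieldType) (z : F) : -1 <= qchar z <= 1.
Proof. by rewrite /qchar; do 2?case: ifP. Qed.

(* The power sums give the value only modulo [p]; the sum and [qchar d] have the
   same parity because [t] and [- t] contribute equally, and the sum is at most
   [p] in absolute value, so the value is exact. *)
Lemma sum_qchar_quadratic (p : nat) (c d : 'F_p) :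
    prime p -> (2 < p)%N -> c != 0 -> d != 0 ->
  \sum_t qchar (d * t ^+ 2 + c) = - qchar d.
Proof.
move=> p_pr p_gt2 c0 d0; have cardF := card_Fp p_pr.
have p_odd : odd p by case: (even_prime p_pr) => // p2; rewrite p2 in p_gt2.
have p1E : #|'F_p|.-1 = p./2.*2 by rewrite cardF; lia.
have h_gt0 : (0 < p./2)%N by lia.
have two0 : (2%:R : 'F_p) != 0.
  by rewrite -(dvdn_pcharf (pchar_Fp p_pr)) gtnNdvd.
set S := \sum_t _.
have pS : (p%:Z %| S + qchar d)%Z.
  rewrite (dvdz_pcharf (pchar_Fp p_pr)) intrD (qcharE _ p1E) // /S rmorph_sum /=.
  under eq_bigr do rewrite (qcharE _ p1E) //.
  have := @sum_quadratic_powers _ p./2 0 c d p1E h_gt0.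
  rewrite subn0 expr0 mulr1 bin0 => M; rewrite -[X in _ + X]opprK -M.
  by rewrite -sumrB big1 // => t _; rewrite mul1r subrr.
have S_odd : exists x : int, S + qchar d = 2 * x.
  have gN (t : 'F_p) : qchar (d * (- t) ^+ 2 + c) = qchar (d * t ^+ 2 + c).
    by rewrite sqrrN.
  rewrite /S (sum_even two0 gN) expr0n mulr0 add0r.
  set R := \sum_(_ | _) _.
  by case: (qchar_cases c0) (qchar_cases d0) => -> [] ->;
    [exists (R + 1) | exists R | exists R | exists (R - 1)]; ring.
have S_bound : (- p%:Z <= S <= p%:Z).
  have -> : p%:Z = \sum_(t : 'F_p) 1.
    by rewrite sumr_const cardF natz.
  rewrite -sumrN; apply/andP; split; apply: ler_sum => t _;
    by have /andP[] := qchar_bound (d * t ^+ 2 + c).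
have /andP[e1 e2] := qchar_bound d.
have [x Ex] := S_odd; have /dvdzP[y Ey] : ((2 * p)%N%:Z %| S + qchar d)%Z.
  rewrite PoszM Gauss_dvdz ?pS ?andbT; first by rewrite Ex dvdz_mulr.
  by rewrite coprimezE /= coprime2n.
(* The absolute value of S + qchar d is at most p + 1 < 2 p. *)
have : y = 0 by rewrite PoszM in Ey; nia.
by move=> y0; apply/eqP; rewrite -addr_eq0 Ey y0 mul0r.
Qed.

(** As h is -1/2 in F, this is the generalized binomial coefficient of -1/2 over 2, equal to 3/8;
    over 4 it is 105/384. *)
Lemma natr_bin2 (F : comNzRingType) (h : nat) : (1 < h)%N -> h%:R * 2 = -1 :> F ->
  8 * 'C(h, 2)%:R = 3 :> F.
Proof.
case: h => [|[|h]] // _; rewrite -[h.+2%:R]natr1 -[h.+1%:R]natr1; set x := h%:R => Eh.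
have : ('C(h.+2, 2) * 2)%N%:R = (h.+2 * h.+1)%N%:R :> F by rewrite bin_ffact ffactnS ffactn1.
rewrite !natrM -[h.+2%:R]natr1 -[h.+1%:R]natr1 -/x => EC.
transitivity (4 * ('C(h.+2, 2)%:R * 2%:R) : F); first by ring.
rewrite EC; transitivity ((x + 1 + 1) * 2 * ((x + 1 + 1) * 2 - 2)); first by ring.
by rewrite Eh; ring.
Qed.

Lemma natr_bin4 (F : comNzRingType) (h : nat) : (3 < h)%N -> h%:R * 2 = -1 :> F ->
  384 * 'C(h, 4)%:R = 105 :> F.
Proof.
case: h => [|[|[|[|h]]]] // _.
rewrite -[h.+4%:R]natr1 -[h.+3%:R]natr1 -[h.+2%:R]natr1 -[h.+1%:R]natr1.
set x := h%:R => Eh.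
have : ('C(h.+4, 4) * 24)%N%:R = (h.+4 * (h.+3 * (h.+2 * h.+1)))%N%:R :> F.
  by rewrite (bin_ffact _ 4) !ffactnS ffactn0 muln1.
rewrite !natrM -[h.+4%:R]natr1 -[h.+3%:R]natr1 -[h.+2%:R]natr1 -[h.+1%:R]natr1 -/x => EC.
transitivity (16 * ('C(h.+4, 4)%:R * 24%:R) : F); first by ring.
rewrite EC; set y := (_ + 1) * 2 in Eh.
transitivity (y * (y - 2) * (y - 4) * (y - 6)); first by rewrite /y; ring.
by rewrite Eh; ring.
Qed.

(** * The Fibonacci sequence modulo primes above 10 *)

Lemma fib_complete_square (p : nat) (t : 'F_p) : prime p -> complete_mod 0 1 p ->
  exists z : 'F_p, z ^+ 2 = 5 * t ^+ 2 + 4 \/ z ^+ 2 = 5 * t ^+ 2 + (- 4).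
Proof.
move=> p_pr /complete_modP/(_ (val t)%:Z)[n].
rewrite (dvdz_pcharf (pchar_Fp p_pr)) rmorphB /= subr_eq0 => /eqP Et.
exists (gibL 0 1 n)%:~R; rewrite -rmorphXn /= gibL_sqr rmorphD /= rmorphM rmorphXn /= Et.
rewrite -signr_odd -[((val t)%:Z)%:~R]/((val t)%:R) natr_Zp.
by case: odd; [right|left]; rewrite /= ?expr1 ?expr0; congr (_ + _); ring.
Qed.

Lemma sum_even_on (F : finFieldType) (V : nmodType) (O : pred F) (G : F -> V) :
    (2%:R : F) != 0 -> (forall t, O (- t) = O t) -> (forall t, G (- t) = G t) ->
  \sum_(t | O t) G t = (if O 0 then G 0 else 0) +
    (\sum_(t in [set t | O t & (enum_rank t < enum_rank (- t))%N]) G t) *+ 2.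
Proof.
move=> two ON GN; rewrite big_mkcond sum_even // => [|t]; last by rewrite ON GN.
congr (_ + _ *+ 2); rewrite -big_mkcondr; apply: eq_bigl => t.
by rewrite inE andbC.
Qed.

Lemma card_quadratic_roots (F : finFieldType) (c d : F) : d != 0 ->
  (#|[pred t : F | d * t ^+ 2 + c == 0 :> F]%R| <= 2)%N.
Proof.
move=> d0; set p := Poly [:: c; 0; d].
have p0 : p != 0.
  by apply: contraNneq d0 => p0; have := coef_Poly [:: c; 0; d] 2; rewrite -/p p0 coef0 /= => <-.
rewrite cardE -ltnS (leq_trans _ (size_Poly [:: c; 0; d])) //.
apply: max_poly_roots; rewrite ?enum_uniq //; apply/allP => t.
rewrite mem_enum inE /root horner_Poly /= => /eqP E; apply/eqP; rewrite -[RHS]E; ring.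
Qed.

(** Cases j = 0, 2, 4 of [sum_quadratic_powers]: 25 and 625 complete 5^(h-j) to 5^h, and 16 . 3/8 =
    6, 256 . 105/384 = 70. *)
Lemma quadratic_moments (F : finFieldType) (h : nat) (c : F) :
    #|F|.-1 = h.*2 -> (4 < h)%N -> (3%:R : F) != 0 -> c ^+ 2 = 16 ->
  [/\ \sum_(t : F) (5 * t ^+ 2 + c) ^+ h = - 5 ^+ h,
      25 * \sum_(t : F) t ^+ 4 * (5 * t ^+ 2 + c) ^+ h = - (6 * 5 ^+ h) &
      625 * \sum_(t : F) t ^+ 8 * (5 * t ^+ 2 + c) ^+ h = - (70 * 5 ^+ h)].
Proof.
move=> q1E h_gt4 three c2.
have Eh : h%:R * 2 = -1 :> F.
  apply/eqP; rewrite -addr_eq0 -natrM natr1 muln2 -q1E.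
  by rewrite (prednK (ltnW (card_finNzRing_gt1 F))) natr_card.
have M j := @sum_quadratic_powers F h j c 5 q1E.
have pow5 j : (j <= h)%N -> 5 ^+ h = 5 ^+ j * 5 ^+ (h - j) :> F.
  by move=> jh; rewrite -exprD subnKC.
split.
- have := M 0%N _; rewrite subn0 expr0 mulr1 bin0 => <-; last by lia.
  by apply: eq_bigr => t _; rewrite mul1r.
- have /M -> : (2 < h)%N by lia.
  rewrite (pow5 2%N) ?c2; last by lia.
  rewrite -[_ *+ 'C(_, _)]mulr_natr.
  set C := 'C(h, 2)%:R; set f := 5 ^+ (h - 2).
  have -> : 6 = 2 * (8 * C) :> F by rewrite natr_bin2 //; [ring|lia].
  by ring.
have /M -> : (4 < h)%N by [].
rewrite (pow5 4%N); last by lia.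
rewrite -[_ *+ 'C(_, _)]mulr_natr.
rewrite -[c ^+ 4]/(c ^+ (2 * 2)) exprM c2; set C := 'C(h, 4)%:R; set f := 5 ^+ (h - 4).
apply: (mulfI three).
have C4 : 384 * C = 105 by apply: natr_bin4 => //; lia.
transitivity (- (2 * (384 * C) * (625 * f))); first by ring.
by rewrite C4; ring.
Qed.

(** The factor A B serves to kill the zeros of A and B. With y = 25 t^4 it is y - 16, and the
    moments -2, -12, -140 of 1, y, y^2 (in units of 5^h) give -12 + 32 = 20 and -140 + 192 = 52. *)
Lemma quadratic_product_moments (F : finFieldType) (h : nat)
    (A := fun t : F => 5 * t ^+ 2 + 4) (B := fun t : F => 5 * t ^+ 2 + (- 4)) :
    #|F|.-1 = h.*2 -> (4 < h)%N -> (3%:R : F) != 0 ->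
  \sum_t (A t ^+ h + B t ^+ h) * (A t * B t * 1) = 20 * 5 ^+ h /\
  \sum_t (A t ^+ h + B t ^+ h) * (A t * B t * (25 * t ^+ 4)) = 52 * 5 ^+ h.
Proof.
move=> q1E h_gt4 three0.
have [|A0 A4 A8] := @quadratic_moments F h 4 q1E h_gt4 three0; first by ring.
have [|B0 B4 B8] := @quadratic_moments F h (- 4) q1E h_gt4 three0; first by ring.
have split_sum (k : F) (f a b : F -> F) : (forall t, f t = k * a t + k * b t) ->
    \sum_t f t = k * (\sum_t a t) + k * (\sum_t b t).
  by move=> fE; rewrite !mulr_sumr -big_split; apply: eq_bigr.
have S0 : \sum_t (A t ^+ h + B t ^+ h) = - (2 * 5 ^+ h).
  by rewrite big_split /= A0 B0; ring.
have S4 : \sum_t (A t ^+ h + B t ^+ h) * (25 * t ^+ 4) = - (12 * 5 ^+ h).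
  rewrite (split_sum 25 _ (fun t => t ^+ 4 * A t ^+ h) (fun t => t ^+ 4 * B t ^+ h)).
    by rewrite A4 B4; ring.
  by move=> t; ring.
have S8 : \sum_t (A t ^+ h + B t ^+ h) * (625 * t ^+ 8) = - (140 * 5 ^+ h).
  rewrite (split_sum 625 _ (fun t => t ^+ 8 * A t ^+ h) (fun t => t ^+ 8 * B t ^+ h)).
    by rewrite A8 B8; ring.
  by move=> t; ring.
have comb (x y : F -> F) : \sum_t (x t - 16 * y t) = \sum_t x t - 16 * \sum_t y t.
  by rewrite mulr_sumr -sumrB.
have AB t : A t * B t = 25 * t ^+ 4 - 16 by rewrite /A /B; ring.
split.
  transitivity (\sum_t ((A t ^+ h + B t ^+ h) * (25 * t ^+ 4) - 16 * (A t ^+ h + B t ^+ h))).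
    by apply: eq_bigr => t _; rewrite AB; move: (A t ^+ h) (B t ^+ h) => a b; ring.
  by rewrite comb S4 S0; ring.
transitivity (\sum_t ((A t ^+ h + B t ^+ h) * (625 * t ^+ 8) -
    16 * ((A t ^+ h + B t ^+ h) * (25 * t ^+ 4)))).
  by apply: eq_bigr => t _; rewrite AB; move: (A t ^+ h) (B t ^+ h) => a b; ring.
by rewrite comb S8 S4; ring.
Qed.

(** The constants come from the elimination in [fib_not_complete_prime]; their prime factors are 2,
    3, 5, 7, 13 and 23. *)
Lemma Fp_natr_neq0 (p n : nat) : prime p -> (10 < p)%N -> p != 13 -> p != 23 ->
  n \in [:: 20; 52; 672; 1472; 1120; 5824]%N -> (n%:R : 'F_p) != 0.
Proof.
move=> p_pr p_gt p13 p23 n_in; rewrite -(dvdn_pcharf (pchar_Fp p_pr)).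
have : all (fun n => (0 < n)%N && all (fun q => [|| q <= 10, q == 13 | q == 23]%N) (primes n))
  [:: 20; 52; 672; 1472; 1120; 5824]%N by vm_compute.
move=> /allP/(_ n n_in)/andP[n_gt0 /allP pn]; apply/negP => dv.
have := pn p; rewrite mem_primes p_pr n_gt0 dv (negPf p13) (negPf p23) leqNgt p_gt.
by move=> /(_ isT).
Qed.

Lemma fib_not_complete_prime (p : nat) : prime p -> (10 < p)%N -> ~ complete_mod 0 1 p.
Proof.
move=> p_pr p_gt cp.
have p13 : p != 13 by apply: contraPneq cp => ->; apply: not_complete_small.
have p23 : p != 23 by apply: contraPneq cp => ->; apply: not_complete_small.
have natr_neq0 n := @Fp_natr_neq0 p n p_pr p_gt p13 p23.
have small n : (0 < n < p)%N -> (n%:R : 'F_p) != 0.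
  by case/andP=> n_gt0 np; rewrite -(dvdn_pcharf (pchar_Fp p_pr)) gtnNdvd.
have two0 : (2%:R : 'F_p) != 0 by apply: small; lia.
have three0 : (3%:R : 'F_p) != 0 by apply: small; lia.
have four0 : (4 : 'F_p) != 0 by apply: small; lia.
have five0 : (5 : 'F_p) != 0 by apply: small; lia.
have p_odd : odd p by case: (even_prime p_pr) => // p2; rewrite p2 in p_gt.
set h := p./2; have cardF := card_Fp p_pr.
have q1E : #|'F_p|.-1 = h.*2 by rewrite cardF /h; lia.
have h_gt4 : (4 < h)%N by rewrite /h; lia.
pose A (t : 'F_p) := 5 * t ^+ 2 + 4; pose B (t : 'F_p) := 5 * t ^+ 2 + (- 4).
have hit t : qchar (A t) != -1 \/ qchar (B t) != -1.
  by have [z [Ez|Ez]] := fib_complete_square t p_pr cp; [left|right];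
    rewrite /A /B -Ez (qchar_sqr _ q1E).
pose O t := (qchar (A t) == 1) && (qchar (B t) == 1).
have AN t : A (- t) = A t by rewrite /A sqrrN.
have BN t : B (- t) = B t by rewrite /B sqrrN.
have ON t : O (- t) = O t by rewrite /O AN BN.
have AB t : A t * B t = 25 * t ^+ 4 - 16 by rewrite /A /B; ring.
have AB0 t : A t = 0 -> B t = 0 -> False.
  move=> At Bt; have : 2 * 4 = 0 :> 'F_p.
    by transitivity (A t - B t); [rewrite /A /B; ring|rewrite At Bt subrr].
  by move=> /eqP; rewrite mulf_eq0 (negPf two0) (negPf four0).
(* By [hit] the two characters are never both -1. There remain a zero of A or B, where the
   indicators make up for a value -1, two nonzero squares, or opposite characters. *)
have val t : [\/ O t = false /\ A t * B t = 0 /\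
     ((A t == 0)%:Z + (B t == 0)%:Z + qchar (A t) + qchar (B t) >= 0),
   O t = true /\ qchar (A t) = 1 /\ qchar (B t) = 1 |
   O t = false /\ qchar (A t) + qchar (B t) = 0].
  rewrite /O; have [At0|At0] := eqVneq (A t) 0.
    apply: Or31; rewrite At0 mul0r {1 3}/qchar eqxx; split=> //; split=> //.
    have [Bt0|Bt0] := eqVneq (B t) 0; first by case: (AB0 t).
    by case: (qchar_cases Bt0) => ->.
  have [Bt0|Bt0] := eqVneq (B t) 0.
    apply: Or31; rewrite Bt0 mulr0 {2 4}/qchar eqxx andbF; split=> //; split=> //.
    by case: (qchar_cases At0) => ->.
  case: (hit t); case: (qchar_cases At0) (qchar_cases Bt0) => -> [] -> //= _;
    by [apply: Or32 | apply: Or33].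
pose H := [set t | O t & (enum_rank t < enum_rank (- t))%N].
have H_le1 : (#|H| <= 1)%N.
  (* Twice the size of O is at most the number of zeros of A and B minus 2 (5/p), hence at most
     6. *)
  have SO : \sum_(t | O t) (2 : int) <=
      \sum_(t : 'F_p) ((A t == 0)%:Z + (B t == 0)%:Z + qchar (A t) + qchar (B t)).
    rewrite big_mkcond; apply: ler_sum => t _.
    have pos (x : int) (i j : bool) : x <= i%:Z + j%:Z + x by rewrite lerDr addr_ge0.
    rewrite -[X in _ <= X]addrA; case: (val t) => [[-> [_]]|[-> [-> ->]]|[-> ->]].
    - by rewrite addrA.
    - exact: pos.
    exact: pos.
  have cardZ (f : 'F_p -> 'F_p) : \sum_t (f t == 0)%:Z = #|[pred t | f t == 0]|%:Z.
    rewrite -sum1_card -natz natr_sum [RHS]big_mkcond; apply: eq_bigr => t _.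
    by rewrite inE; case: eqP.
  have nfour0 : (- 4 : 'F_p) != 0 by rewrite oppr_eq0.
  have p_gt2 : (2 < p)%N by apply: ltn_trans p_gt.
  have SA := sum_qchar_quadratic p_pr p_gt2 four0 five0.
  have SB := sum_qchar_quadratic p_pr p_gt2 nfour0 five0.
  have ZA := card_quadratic_roots 4 five0; have ZB := card_quadratic_roots (- 4) five0.
  have OE : \sum_(t | O t) (2 : int) =
      (if O 0 then 2 else 0) + (\sum_(t in H) 2) *+ 2 :=
    @sum_even_on _ int O (fun=> 2) two0 ON (fun=> erefl).
  rewrite OE sumr_const !big_split !cardZ SA SB in SO.
  have /andP[e1 _] := qchar_bound (5 : 'F_p).
  have O0 : 0 <= (if O 0 then 2 else 0 : int) by case: (O 0).
  move: (qchar _) (if _ then _ else _) #|_| #|_| #|H| SO ZA ZB e1 O0.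
  clear=> q x a b w SO *.
  have {}SO : x + w%:Z * 4 <= b%:Z + a%:Z - q - q.
    rewrite (_ : w%:Z * 4 = 2 *+ w *+ 2) //.
    by rewrite -mulrnA -[2 *+ _]mulr_natl natrM (natz w); ring.
  lia.
pose e : 'F_p := 5 ^+ h.
have ee : e * e = 1.
  by rewrite -expr2 -exprM muln2 -q1E expf_card1.
have [W1 W2] := quadratic_product_moments q1E h_gt4 three0.
(* Outside O either A B vanishes or the characters cancel; on O they add up to 2. *)
have onO (g : 'F_p -> 'F_p) : \sum_t (A t ^+ h + B t ^+ h) * (A t * B t * g t) =
    \sum_(t | O t) 2 * (A t * B t * g t).
  rewrite [RHS]big_mkcond; apply: eq_bigr => t _.
  rewrite -!(qcharE _ q1E) ?(ltn_trans _ h_gt4) // -intrD.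
  by case: (val t) => [[-> [-> _]]|[-> [-> ->]]|[-> ->]] //; rewrite ?mul0r ?mulr0.
rewrite -/e -/(A _) -/(B _) !onO in W1 W2.
move: W1 W2; rewrite !(sum_even_on two0 ON) -/H; last first.
- by move=> t; rewrite AN BN.
- by move=> t; rewrite AN BN -[(- t) ^+ 4]/((- t) ^+ (2 * 2)) exprM sqrrN -exprM.
have e_cancel n : n%:R * e = 0 -> n%:R = 0 :> 'F_p.
  by move=> ne; rewrite -[LHS]mulr1 -[X in _ * X]ee mulrA ne mul0r.
have elim_e x y : x + y * e = 0 -> (y - x) * (y + x) = 0.
  move=> /eqP; rewrite addr_eq0 => /eqP ->.
  by transitivity (y ^+ 2 * (1 - e * e)); [ring|rewrite ee subrr mulr0].
have A0B0 : A 0 * B 0 = - 16 by rewrite AB; ring.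
have [H0|/eqP/cards1P[s ->]] : #|H| = 0%N \/ #|H| = 1%N by lia.
  (* Only t = 0 can contribute. If it lies in O, its weight 25 t^4 is 0 and the second relation
     gives 52 e = 0; otherwise the first gives 20 e = 0. *)
  rewrite (cards0_eq H0) !big_set0 A0B0.
  case: (O 0) => W1 W2.
    have /e_cancel/eqP : 52 * e = 0 by rewrite -W2; ring.
    by rewrite (negPf (natr_neq0 52 isT)).
  have /e_cancel/eqP : 20 * e = 0 by rewrite -W1; ring.
  by rewrite (negPf (natr_neq0 20 isT)).
rewrite !big_set1 A0B0 AB; set y := 25 * s ^+ 4.
have absurd m n : m \in [:: 20; 52; 672; 1472; 1120; 5824]%N ->
    n \in [:: 20; 52; 672; 1472; 1120; 5824]%N -> m%:R * n%:R <> 0 :> 'F_p.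
  by move=> m_in n_in /eqP; rewrite mulf_eq0 !(negPf (natr_neq0 _ _)).
(* Eliminating [y] leaves a relation [x + z * e = 0], and [e ^+ 2 = 1] turns it
   into [(z - x) * (z + x) = 0]. *)
case: (O 0) => W1 W2.
  have Ey : 4 * y = 96 + 20 * e.
    by rewrite -W1; ring.
  have /elim_e E : 3472 + 2352 * e = 0.
    transitivity (400 * (1 - e * e) + ((96 + 20 * e) * (96 + 20 * e - 64) - 4 * (52 * e))).
      by ring.
    by rewrite -W2 -Ey ee; ring.
  by apply: (absurd 5824 1120)%N => //; rewrite -[RHS]oppr0 -E; ring.
have Ey : 4 * y = 64 + 20 * e by rewrite -W1; ring.
have /elim_e E : 400 + 1072 * e = 0.
  transitivity (400 * (1 - e * e) + ((64 + 20 * e) * (64 + 20 * e - 64) - 4 * (52 * e))).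
    by ring.
  by rewrite -W2 -Ey ee; ring.
by apply: (absurd 672 1472)%N => //; rewrite -E; ring.
Qed.

(** * Classification *)

Lemma smooth_factor (ps : seq nat) m : (0 < m)%N ->
    (forall p, prime p -> (p %| m)%N -> p \in ps) ->
  exists e : nat -> nat, m = (\prod_(p <- undup ps) p ^ e p)%N.
Proof.
move=> m_gt0 Hm; exists (fun p => logn p m).
rewrite {1}(prod_prime_decomp m_gt0) prime_decompE big_map /=.
rewrite [RHS](bigID (mem (primes m))) /= [X in (_ * X)%N]big1 ?muln1; last first.
  move=> p; rewrite mem_primes m_gt0 /= => pm; have [p_pr|] := boolP (prime p).
    by rewrite lognE p_pr m_gt0 (negPf (_ : ~~ (p %| m)%N)) //; move: pm; rewrite p_pr.
  by move=> /negPf npr; rewrite lognE npr.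
rewrite -[RHS]big_filter; apply: perm_big; apply: uniq_perm.
- exact: primes_uniq.
- by rewrite filter_uniq ?undup_uniq.
move=> p; rewrite mem_filter mem_undup; apply/idP/andP => [pm|[]//].
by split=> //; move: pm; rewrite mem_primes => /and3P[? _]; apply: Hm.
Qed.

(** Completeness passes to divisors, so m has only the primes 2, 3, 5, 7 and no divisor among 8, 12,
    18, 21, 28, 49. This leaves 1, 2, 4, 3^j, 6, 7 or 14 as the part prime to 5. *)
Lemma complete_MF m : (1 < m)%N -> complete_mod 0 1 m -> MF_explicit m.
Proof.
move=> m_gt1 cm; split; first by move=> m1; rewrite m1 in m_gt1.
have m_gt0 := ltnW m_gt1.
have [|e Em] := @smooth_factor [:: 2; 3; 5; 7]%N m m_gt0.
  move=> p p_pr pm; have := @fib_not_complete_prime p p_pr.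
  case: ltnP => [_ /(_ isT)[]|p_le _]; first exact: complete_dvd cm.
  by move: p_pr p_le {pm}; do 11?[case: p => [|p] //].
move: Em; rewrite /= !big_cons big_nil muln1.
set i := e 2; set j := e 3; set k := e 5; set l := e 7.
move=> Em.
have ndvd d : d \in [:: 8; 12; 18; 21; 28; 49]%N -> ~~ (d %| 2 ^ i * (3 ^ j * 7 ^ l))%N.
  move=> d_in; apply/negP => dm.
  have /complete_dvd/(_ cm) : (d %| m)%N.
    apply: dvdn_trans dm _; apply/dvdnP; exists (5 ^ k)%N.
    by rewrite Em (mulnCA (3 ^ j)%N) (mulnCA (2 ^ i)%N).
  by apply: not_complete_small; move: d_in; rewrite !inE; lia.
have dv x y z : (x <= i -> y <= j -> z <= l ->
    2 ^ x * (3 ^ y * 7 ^ z) %| 2 ^ i * (3 ^ j * 7 ^ l))%N.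
  by move=> *; rewrite !dvdn_mul ?dvdn_exp2l.
have n8 : (i < 3)%N by rewrite ltnNge; apply: contra (ndvd 8 isT) => ?; apply: (dv 3 0 0).
have n12 : ~~ ((1 < i) && (0 < j))%N.
  by apply: contra (ndvd 12 isT) => /andP[? ?]; apply: (dv 2 1 0).
have n18 : ~~ ((0 < i) && (1 < j))%N.
  by apply: contra (ndvd 18 isT) => /andP[? ?]; apply: (dv 1 2 0).
have n21 : ~~ ((0 < j) && (0 < l))%N.
  by apply: contra (ndvd 21 isT) => /andP[? ?]; apply: (dv 0 1 1).
have n28 : ~~ ((1 < i) && (0 < l))%N.
  by apply: contra (ndvd 28 isT) => /andP[? ?]; apply: (dv 2 0 1).
have n49 : (l < 2)%N by rewrite ltnNge; apply: contra (ndvd 49 isT) => ?; apply: (dv 0 0 2).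
exists k; rewrite Em; move: (5 ^ k)%N => K.
clearbody i j k l; case: l n21 n28 n49 {dv ndvd Em} => [|[|l]] // n21 n28 _.
  case: j n12 n18 n21 => [|j] n12 n18 _.
    by case: i n8 {n12 n18 n28} => [|[|[|i]]] // _; rewrite ?expn0 ?muln1 ?mul1n; tauto.
  case: i n8 n12 n18 n28 => [|[|i]] // _ _ n18 _; last first.
    case: j n18 => [|j] // _; right; right; right; right; left.
    by rewrite mulnA muln1.
  by right; right; right; left; exists j.+1; rewrite mul1n muln1.
case: j n12 n18 n21 => [|j] // _ _ _; case: i n8 n28 => [|[|i]] // _ _.
  by do 5!right; left; rewrite !mul1n mulnC.
by do 6!right; rewrite mul1n (mulnC K) mulnA.
Qed.

(** * The dichotomy modulo 5 *)

Lemma gibL_dvd5 a b n : (5 %| a ^+ 2 + a * b - b ^+ 2)%Z -> (5 %| gibL a b n)%Z.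
Proof.
move=> D5; rewrite -(@prime_dvdzX 5 _ 2) // gibL_sqr dvdz_addl; last exact: dvdz_mulr.
rewrite dvdz_mull // -rpredN.
by congr (is_true (_ %| _)%Z): D5; ring.
Qed.

(** As 5 divides every L_n, g_n = 2 g_(n+1) modulo 5, so a zero term would propagate back to a, and
    then 5 would divide b too. *)
Lemma gib_not_complete5 a b : coprimez a b -> (5 %| a ^+ 2 + a * b - b ^+ 2)%Z ->
  ~ complete_mod a b 5.
Proof.
move=> cab D5 /complete_modP/(_ 0)[n]; rewrite subr0; apply/negP.
have L5 := gibL_dvd5 _ D5; elim: n => [|n]; last first.
  by apply: contra => dvS; move: (L5 n); rewrite -rpredN /gibL opprB -[_ - _]/(_ + _)
    addrC dvdz_addl // rpredN dvdz_mull.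
apply/negP => a5; have := L5 0%N; rewrite /gibL addrC dvdz_addl ?rpredN //.
rewrite (@prime_dvdzM 5) //= => b5.
by have := dvdz_gcd 5 a b; rewrite a5 b5 (eqP cab).
Qed.

Lemma MF_ndvd5 m : MF_explicit m -> ~~ (5 %| m)%N -> ML_explicit m.
Proof.
move=> [m1 [[|k] mF]].
  rewrite /ML_explicit; case: mF => [//|[->|[->|[[j [j_gt0 ->]]|[->|[->|->]]]]]] _;
    rewrite muln1; [tauto | tauto | | tauto | tauto | tauto].
  by do 5!right; exists j.
by case: mF => [|[|[|[[j [_]]|[|[]]]]]] ->; rewrite expnS ?(mulnCA _ 5) dvdn_mulr.
Qed.

Lemma gib_MF a b m : coprimez a b -> ~ (5 %| a ^+ 2 + a * b - b ^+ 2)%Z ->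
  M_ab a b m <-> MF_explicit m.
Proof.
move=> cab /negP D5; split; last exact: MF_complete.
by case=> m_gt1 /(complete_fib (ltnW m_gt1)); apply: complete_MF.
Qed.

Lemma gib_ML a b m : coprimez a b -> (5 %| a ^+ 2 + a * b - b ^+ 2)%Z ->
  M_ab a b m <-> ML_explicit m.
Proof.
move=> cab D5; split; last exact: ML_complete.
case=> m_gt1 cm; apply: MF_ndvd5.
  exact: complete_MF (complete_fib (ltnW m_gt1) cm).
by apply/negP => /complete_dvd/(_ cm); apply: gib_not_complete5.
Qed.

Theorem mainTheorem16 (a b : int) (hab : coprimez a b) :
  ((5 %| a ^+ 2 + a * b - b ^+ 2)%Z ->
     forall m : nat, (M_ab a b m <-> M_L m) /\ (M_L m <-> ML_explicit m)) /\
  (~ (5 %| a ^+ 2 + a * b - b ^+ 2)%Z ->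
     forall m : nat, (M_ab a b m <-> M_F m) /\ (M_F m <-> MF_explicit m)).
Proof.
split=> D5 m.
  (* For (1, 3) the form takes the value 1 + 3 - 9 = -5; for (1, 1) below it is 1. *)
  have L : M_L m <-> ML_explicit m by apply: gib_ML.
  by split=> //; rewrite L; apply: gib_ML.
have F : M_F m <-> MF_explicit m by apply: gib_MF.
by split=> //; rewrite F; apply: gib_MF.
Qed.
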